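(* Let $r\ge 0$ be an integer and let $\Delta$ be a connected, pure $2$-dimensional simplicial complex of genus $0$ embedded in $\mathbb{R}^2$, such that at every interior vertex, no partially interior edge has the same slope as a totally interior edge. If $\Delta$ has only one totally interior edge, then $\operatorname{reg} H_0(J_\bullet)\le 2r$.
   Context: Let $S=\mathbb{R}[x,y,z]$ with the standard grading. Genus $0$ means that $\Delta$ has no holes. $\Delta_1^\circ$ and $\Delta_0^\circ$ denote the sets of interior edges and interior vertices of $\Delta$ (those not contained in the boundary $\partial\Delta$). An edge is totally interior if both of its endpoints are interior vertices, and partially interior if exactly one endpoint is an interior vertex. Embed $\Delta$ in $\mathbb{R}^3$ by $(x,y)\mapsto(x,y,1)$. For an edge $\tau$ let $l_{\hat\tau}\in S$ be a (nonzero) linear form vanishing on the cone $\hat\tau$ of $\tau$ over the origin. Put $J(\tau)=\langle l_{\hat\tau}^{\,r+1}\rangle\subset S$ and, for an interior vertex $v$, $J(v)=\sum_{\tau\ni v}J(\tau)$, the sum over edges $\tau$ containing $v$. The ideal complex is $$J_\bullet:\quad 0\to\bigoplus_{\tau\in\Delta_1^\circ}J(\tau)\xrightarrow{\ \partial\ }\bigoplus_{v\in\Delta_0^\circ}J(v)\to 0,$$ where $\partial$ is the restriction of the boundary map of the relative simplicial chain complex $C_\bullet(\Delta,\partial\Delta)$ with coefficients in $S$. $H_0(J_\bullet)$ is the cokernel of $\partial$, a graded $S$-module of finite length. For a graded $S$-module $M$ of finite length, $\operatorname{reg}M=\max\{d\ge 0: M_d\ne 0\}$. *)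

(* Defs.v *)
(* mpoly must be imported before the analysis libraries: in the other order
   their notation levels conflict. *)
From HB Require Import structures.
From mathcomp Require Import all_boot all_order all_algebra.
From mathcomp Require Import mpoly.
From mathcomp Require Import boolp classical_sets reals ereal topology normedtype.

Set Implicit Arguments.
Unset Strict Implicit.
Unset Printing Implicit Defensive.

Import Order.TTheory GRing.Theory Num.Theory numFieldNormedType.Exports.
Local Open Scope ring_scope.

Section Geometry.
Context {R : realType} {V : finType}.

Definition hull (pos : V -> 'rV[R]_2) (s : {set V}) : set 'rV[R]_2 :=
  [set p | exists w : V -> R,
    [/\ forall v, 0 <= w v, \sum_(v in s) w v = 1
      & p = \sum_(v in s) w v *: pos v]]%classic.

Definition affinely_independent (pos : V -> 'rV[R]_2) (s : {set V}) : Prop :=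
  forall w : V -> R, \sum_(v in s) w v = 0 -> \sum_(v in s) w v *: pos v = 0 ->
    forall v, v \in s -> w v = 0.

End Geometry.

(* Finite simplicial complexes linearly embedded in the plane. Simplices are
   nonempty; elements v of V with [set v] not a face play no role. *)
Record planar_complex (R : realType) (V : finType) := PlanarComplex {
  faces : {set {set V}};
  pos : V -> 'rV[R]_2;
  face_neq0 : forall s, s \in faces -> (0 < #|s|)%N;
  face_sub : forall s t : {set V},
    s \in faces -> t \subset s -> (0 < #|t|)%N -> t \in faces;
  face_indep : forall s, s \in faces -> affinely_independent pos s;
  face_meet : forall s t, s \in faces -> t \in faces ->
    (hull pos s `&` hull pos t)%classic = hull pos (s :&: t) }.

Section Complex.
Context {R : realType} {V : finType}.
Variable D : planar_complex R V.

Definition realization : set 'rV[R]_2 :=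
  [set p | exists2 s, s \in faces D & hull (pos D) s p]%classic.

Definition pure2 : Prop :=
  (exists s, s \in faces D) /\
  forall s, s \in faces D -> exists t, [/\ t \in faces D, s \subset t & #|t| = 3%N].

(* A hole is a bounded connected component of the complement of the
   geometric realization. *)
Definition is_hole (H : set 'rV[R]_2) : Prop :=
  (exists2 p, ~ realization p &
     H = connected_component (~` realization)%classic p) /\
  bounded_set H.

Definition genus0 : Prop := forall H, ~ is_hole H.

Definition is_edge (t : {set V}) : bool := (t \in faces D) && (#|t| == 2%N).

Definition boundary_edge (t : {set V}) : bool :=
  is_edge t && (#|[set s in faces D | (#|s| == 3%N) && (t \subset s)]%SET| == 1%N).

(* The boundary complex: the subcomplex generated by the edges lying in
   exactly one triangle. *)
Definition boundary_complex : {set {set V}} :=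
  [set s in faces D | [exists t, boundary_edge t && (s \subset t)]]%SET.

Definition interior_face (s : {set V}) : bool :=
  (s \in faces D) && (s \notin boundary_complex).

Definition interior_vertex (v : V) : bool := interior_face [set v]%SET.

Definition interior_edge (t : {set V}) : bool := is_edge t && interior_face t.

Definition totally_interior (t : {set V}) : bool :=
  is_edge t && (#|[set v in t | interior_vertex v]%SET| == 2%N).

Definition partially_interior (t : {set V}) : bool :=
  is_edge t && (#|[set v in t | interior_vertex v]%SET| == 1%N).

(* Slope of the line through two points, None standing for a vertical line. *)
Definition slope (p q : 'rV[R]_2) : option R :=
  if p 0 0 == q 0 0 then None
  else Some ((q 0 1 - p 0 1) / (q 0 0 - p 0 0)).

Definition slope_condition : Prop :=
  forall v a b : V, interior_vertex v ->
    partially_interior [set v; a]%SET -> totally_interior [set v; b]%SET ->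
    slope (pos D v) (pos D a) <> slope (pos D v) (pos D b).

Local Notation S := {mpoly R[3]}.

(* The points of R^3 (as coordinate functions) on the cone over the origin of
   s placed in the plane z = 1. *)
Definition cone (s : {set V}) : set ('I_3 -> R) :=
  [set c | exists2 p, hull (pos D) s p &
     exists2 k : R, 0 <= k & c = tnth [tuple k * p 0 0; k * p 0 1; k]]%classic.

Definition edge_forms (l : {set V} -> S) : Prop :=
  forall t, is_edge t ->
    [/\ l t \is 1.-homog, l t != 0 & forall c, cone t c -> (l t).@[c] = 0].

(* Coefficient of u in the simplicial boundary of s, vertices being ordered by
   enum_rank: deleting the i-th vertex has sign (-1)^i. *)
Definition bd_coef (s u : {set V}) : S :=
  \sum_(x in s | s :\ x == u)
     (-1) ^+ #|[set y in s | (enum_rank y < enum_rank x)%N]%SET|.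

Variables (r : nat) (l : {set V} -> S).

Definition J1 (t : {set V}) : set S :=
  [set f | exists g, f = g * l t ^+ r.+1]%classic.

Definition J0 (v : V) : set S :=
  [set f | exists2 h : {set V} -> S,
     (forall t, is_edge t -> v \in t -> J1 t (h t)) &
     f = \sum_(t | is_edge t && (v \in t)) h t]%classic.

(* The terms of the complex, as families vanishing off the interior faces. *)
Definition chains1 : set {ffun {set V} -> S} :=
  [set G | forall t, if interior_edge t then J1 t (G t) else G t = 0]%classic.

Definition chains0 : set {ffun V -> S} :=
  [set F | forall v, if interior_vertex v then J0 v (F v) else F v = 0]%classic.

(* The boundary map relative to the boundary complex: components at boundary
   vertices are dropped. *)
Definition bd (G : {ffun {set V} -> S}) : {ffun V -> S} :=
  [ffun v => if interior_vertex v
             then \sum_(t | interior_edge t) bd_coef t [set v]%SET * G t else 0].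

Definition boundaries : set {ffun V -> S} := [set bd G | G in chains1]%classic.

(* Elements of the cokernel H_0 are cosets of boundaries in chains0. *)
Definition coset0 (F : {ffun V -> S}) : set {ffun V -> S} :=
  [set F' | boundaries (F' - F)]%classic.

Definition H0_deg (d : nat) : set (set {ffun V -> S}) :=
  [set coset0 F | F in
     chains0 `&` [set F | forall v, F v \is d.-homog]]%classic.

(* The regularity of the finite length module H_0, as an extended real so that
   the zero module gets -oo. *)
Definition reg_H0 : \bar R :=
  ereal_sup [set (d%:R)%:E | d in
    [set d : nat | exists2 c, H0_deg d c & c <> coset0 0]]%classic.

End Complex.

(* Main.v *)
Require Import Defs.
From HB Require Import structures.
From mathcomp Require Import all_boot all_order all_algebra.
From mathcomp Require Import mpoly.
From mathcomp Require Import boolp classical_sets reals ereal topology normedtype.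
From mathcomp Require Import zify ring lra.

Set Implicit Arguments.
Unset Strict Implicit.
Unset Printing Implicit Defensive.

Import Order.TTheory GRing.Theory Num.Theory numFieldNormedType.Exports.
Local Open Scope ring_scope.

(** Let l0 be the form of the totally interior edge v w. Modulo boundaries every
    0-chain is concentrated at v and of the form g * l0 ^+ r.+1: an edge with a
    single interior end has a relative boundary concentrated at that end, so its
    contribution dies, and the boundary of the edge v w moves what sits at w
    to v. For a chain of degree d > 2 r the factor g can be taken homogeneous of
    degree e = d - r - 1, and e >= r. So it is enough that every form of
    degree e >= r lies in Q + Q', where Q is the ideal of the f for which
    f * l0 ^+ r.+1 is a combination of the (r+1)-st powers of the forms of
    the partially interior edges at v, and Q' is its analogue at w.

    Geometry. Every edge at an interior vertex lies in at least two
    triangles. This gives a triangle v w x, and then a triangle v x z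
    with z != w: the edges v x and v z are partially interior, are not
    parallel, and by the slope condition are not parallel to v w
    ([edges_at_interior_vertex]). Let m be the form of v x, and n the form
    of an edge chosen in the same way at w. Then the form of v z is
    c m + b l0 with b, c nonzero, and l0, m, n is a basis of the linear forms.

    Algebra. In two variables, the multiples of the (r+1)-st powers of two linear
    forms and of a suitable power of a third one span all forms of a given degree,
    as a dimension count predicts ([three_powers_span]). Hence, when r <= 2 i + j, the monomial m^i l0^j
    is congruent modulo Q to a combination of monomials of the same degree
    with smaller exponents of m ([pencil_reduction]), and the same holds for
    n^k l0^j modulo Q' when r <= 2 k + j. A monomial m^i n^k l0^j which
    cannot be reduced satisfies 2 i + j < r and 2 k + j < r, hence
    i + j + k < r. So in degrees at least r everything reduces to 0
    ([monomials_in_sum_of_colons]). *)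

(** * Powers of linear polynomials in one variable *)

Section Univariate.
Context {F : numFieldType}.
Implicit Types (p g h k : {poly F}) (a b : F).

(** A Bezout relation between the two coprime powers; reducing the first cofactor
    modulo the second power makes both cofactors as small as the size of p
    permits. *)
Lemma poly_bezout a b n c p : a != b -> (n <= c)%N -> (size p <= c + n)%N ->
  exists g h : {poly F}, [/\ (size g <= c)%N, (size h <= c)%N &
    p = ('X - a%:P) ^+ n * g + ('X - b%:P) ^+ n * h].
Proof.
move=> ab nc sp.
have /Bezout_eq1_coprimepP [[u v] /= uv] :
    coprimep (('X - a%:P) ^+ n) (('X - b%:P) ^+ n).
  by apply/coprimep_expl/coprimep_expr; rewrite coprimep_XsubC root_XsubC eq_sym.
set A : {poly F} := ('X - a%:P) ^+ n in uv *.
set B : {poly F} := ('X - b%:P) ^+ n in uv *.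
have sA : size A = n.+1 by rewrite size_exp_XsubC.
have sB : size B = n.+1 by rewrite size_exp_XsubC.
have B0 : B != 0 by rewrite -size_poly_eq0 sB.
pose g : {poly F} := (p * u) %% B.
pose h : {poly F} := p * v + A * ((p * u) %/ B).
have e : p = A * g + B * h.
  have -> : g = p * u - (p * u) %/ B * B.
    by rewrite {1}(divp_eq (p * u) B) addrAC subrr add0r.
  rewrite -{1}[p]mulr1 -uv /h; ring.
have sg : (size g <= n)%N by rewrite -ltnS -sB ltn_modp.
exists g, h; split => //; first exact: leq_trans nc.
have : (size (B * h)%R <= c + n)%N.
  have -> : B * h = p - A * g by rewrite {1}e addrAC subrr add0r.
  apply: leq_trans (size_polyD _ _) _; rewrite size_polyN geq_max sp /=.
  apply: leq_trans (size_polyMleq _ _) _; rewrite sA addSn /= addnC.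
  by rewrite leq_add2r (leq_trans sg).
have [->|h0] := eqVneq h 0; first by rewrite size_poly0.
by rewrite size_monicM ?monic_exp ?monicXsubC // sB addSn /= [(c + n)%N]addnC leq_add2l.
Qed.

(** Antidifferentiation can be done termwise in the expansion around a, where it
    sends (X - a)^k to a multiple of (X - a)^(k+1): it raises the order of
    vanishing at a, and the cofactor does not grow. *)
Lemma antideriv_XsubC_exp1 a c n g : (size g <= c)%N ->
  exists2 q : {poly F}, (size q <= c)%N &
    (('X - a%:P) ^+ n.+1 * q)^`() = ('X - a%:P) ^+ n * g.
Proof.
elim: c n g => [|c IH] n g sg.
  have -> : g = 0 by apply/eqP; rewrite -size_poly_leq0.
  by exists 0; rewrite ?size_poly0 // !mulr0 deriv0.
pose e := g.[a].
have /factor_theorem[q' /(canRL (subrK _)) eg] : root (g - e%:P) a.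
  by rewrite rootE !hornerE subrr.
have sq' : (size q' <= c)%N.
  have [->|q0] := eqVneq q' 0; first by rewrite size_poly0.
  move: sg; rewrite eg size_polyDl size_Mmonic ?monicXsubC // size_XsubC addn2 //=.
  by rewrite (leq_ltn_trans (size_polyC_leq1 _)) // ltnS size_poly_gt0.
have [q sq dq] := IH n.+1 _ sq'.
exists (('X - a%:P) * q + (e / n.+1%:R)%:P).
  apply: leq_trans (size_polyD _ _) _; rewrite geq_max.
  rewrite (leq_trans (size_polyC_leq1 _)) // andbT.
  by apply: leq_trans (size_polyMleq _ _) _; rewrite size_XsubC.
rewrite mulrDr mulrA -exprSr derivD dq derivM derivC mulr0 addr0.
rewrite deriv_exp derivXsubC mul1r /= mulrnAl -mulrnAr -polyCMn.
rewrite -[_ *+ n.+1]mulr_natr mulfVK ?pnatr_eq0 //.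
by rewrite [in RHS]eg mulrDr exprSr mulrA -!mulrA [q' * _]mulrC.
Qed.

Lemma antideriv_XsubC_exp a c n N g : (size g <= c)%N ->
  exists2 q : {poly F}, (size q <= c)%N &
    (('X - a%:P) ^+ (n + N) * q)^`(N) = ('X - a%:P) ^+ n * g.
Proof.
elim: N n g => [|N IH] n g sg; first by exists g; rewrite // addn0.
have [q sq dq] := antideriv_XsubC_exp1 a n sg.
have [q' sq' dq'] := IH n.+1 _ sq.
by exists q'; rewrite // addnS -addSn derivnS dq' dq.
Qed.

Lemma size_derivn_eq0 N p : p^`(N) = 0 -> (size p <= N)%N.
Proof.
move=> dp; apply/leq_sizeP => j Nj.
have := coef_derivn N p (j - N); rewrite subnKC // dp coef0 => /esym/eqP.
by rewrite mulrn_eq0 -leqn0 leqNgt ffact_gt0 Nj /= => /eqP.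
Qed.

(** Differentiating r - s times kills k and turns the claim into the Bezout
    relation for the powers of exponent r.+1 - (r - s); antidifferentiation
    brings the two terms back with their order of vanishing, and what is left has
    zero (r - s)-th derivative. Homogeneously, with X - a, X - b and 1 replaced by
    linear forms x', z' and y, the forms of degree s + r + 1 are spanned by the
    multiples of x'^(r+1), z'^(r+1) and y^(2s+2). *)
Lemma three_powers_span a b r s p : a != b -> (size p <= s + r.+2)%N ->
  exists g h k : {poly F}, [/\ (size g <= s.+1)%N, (size h <= s.+1)%N, (size k <= r - s)%N &
    p = ('X - a%:P) ^+ r.+1 * g + ('X - b%:P) ^+ r.+1 * h + k].
Proof.
move=> ab sp; set N := (r - s)%N; set n := (r.+1 - N)%N.
have sdp : (size p^`(N) <= s.+1 + n)%N.
  apply/leq_sizeP => j jN; rewrite coef_derivn nth_default ?mul0rn //.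
  by apply: leq_trans sp _; rewrite /n /N in jN *; lia.
have ns : (n <= s.+1)%N by rewrite /n /N; lia.
have [g1 [h1 [sg1 sh1 e1]]] := poly_bezout ab ns sdp.
have [g sg dg] := antideriv_XsubC_exp a n N sg1.
have [h sh dh] := antideriv_XsubC_exp b n N sh1.
have nN : (n + N = r.+1)%N by rewrite /n /N; lia.
rewrite nN in dg dh.
exists g, h, (p - (('X - a%:P) ^+ r.+1 * g + ('X - b%:P) ^+ r.+1 * h)).
split=> //; last by rewrite [RHS]addrC subrK.
by apply: size_derivn_eq0; rewrite derivnB derivnD dg dh e1 subrr.
Qed.

End Univariate.

(** * Pencils of linear forms and reduction of monomials *)

Section Homogenization.
Context {F : numFieldType} {A : comAlgType F}.
Implicit Types (p q : {poly F}) (x y : A).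

(** Taking the degree d as a parameter, instead of the degree of p, makes
    homogenization additive in p. *)
Definition homogenize d p x y : A :=
  \sum_(i < d.+1) p`_i *: (x ^+ i * y ^+ (d - i)).

Lemma homogenizeD d p q x y :
  homogenize d (p + q) x y = homogenize d p x y + homogenize d q x y.
Proof.
by rewrite -big_split; apply: eq_bigr => i _; rewrite /= coefD scalerDl.
Qed.

Lemma homogenizeXn d i x y : (i <= d)%N ->
  homogenize d 'X^i x y = x ^+ i * y ^+ (d - i).
Proof.
move=> id; rewrite /homogenize (bigD1 (Ordinal (id : (i < d.+1)%N))) //=.
rewrite coefXn eqxx scale1r big1 ?addr0 // => j ji.
by rewrite coefXn (negPf (ji : (j : nat) != i)) scale0r.
Qed.

Lemma homogenize_XsubC d a p x y : (size p <= d.+1)%N ->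
  homogenize d.+1 (('X - a%:P) * p) x y = (x - a *: y) * homogenize d p x y.
Proof.
move=> sp; rewrite mulrBl /homogenize !mulr_sumr.
under eq_bigr => i _ do rewrite coefB coefXM coefCM scalerBl.
rewrite sumrB big_ord_recl /= scale0r add0r.
rewrite [X in _ - X]big_ord_recr /= nth_default // mulr0 scale0r addr0.
rewrite -sumrB; apply: eq_bigr => i _; rewrite /bump /= add1n subSS.
rewrite subSn; last by rewrite -ltnS ltn_ord.
rewrite -!scalerAr mulrBl scalerBr -!scalerAl scalerA !exprS !mulrA.
by rewrite [y * _]mulrC -!mulrA [a * _]mulrC.
Qed.

Lemma homogenize_XsubC_exp d n a p x y : (size p <= d.+1)%N ->
  homogenize (n + d) (('X - a%:P) ^+ n * p) x y =
  (x - a *: y) ^+ n * homogenize d p x y.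
Proof.
move=> sp; elim: n => [|n IH]; first by rewrite !expr0 !mul1r.
rewrite !exprS -!mulrA addSn homogenize_XsubC ?IH //.
apply: leq_trans (size_polyMleq _ _) _.
by rewrite size_exp_XsubC addSn /= -addnS leq_add2l.
Qed.

(** The product x^i y^j y^(r+1) is the homogenization of 'X^i in degree
    i + j + r + 1, and z is proportional to x - (- (b / c)) y: homogenizing
    [three_powers_span] for 'X^i with roots 0 and - (b / c) gives the claim. *)
Lemma pencil_reduction (x y z : A) (b c : F) r i j :
    b != 0 -> c != 0 -> z = c *: x + b *: y -> (r <= 2 * i + j)%N ->
  exists (e : nat -> F) (u w : A),
    (x ^+ i * y ^+ j - \sum_(k < r - (i + j)) e k *: (x ^+ k * y ^+ (i + j - k)))
      * y ^+ r.+1 = u * x ^+ r.+1 + w * z ^+ r.+1.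
Proof.
move=> b0 c0 zE rij; set s := (i + j)%N.
have sX : (size ('X^i : {poly F}) <= s + r.+2)%N by rewrite size_polyXn /s; lia.
have ab : 0 != - (b / c) by rewrite eq_sym oppr_eq0 mulf_neq0 ?invr_neq0.
have [g [h [k [sg sh sk e]]]] := three_powers_span ab sX.
have {}zE : x - (- (b / c)) *: y = c^-1 *: z.
  by rewrite zE scalerDr !scalerA mulVf // scale1r mulrC scaleNr opprK.
exists (fun n => k`_n), (homogenize s g x y), (c^-1 ^+ r.+1 *: homogenize s h x y).
have := congr1 (fun p => homogenize (r.+1 + s) p x y) e.
rewrite !homogenizeD !homogenize_XsubC_exp // scale0r subr0 zE.
rewrite homogenizeXn; last by rewrite /s; lia.
(* All the exponents of x in k are below r - s <= i <= s, so y has exponent at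
   least r.+1 in each term. *)
have -> : homogenize (r.+1 + s) k x y =
    (\sum_(n < r - s) k`_n *: (x ^+ n * y ^+ (s - n))) * y ^+ r.+1.
  rewrite /homogenize mulr_suml.
  rewrite (bigID (fun n : 'I_ _ => (n < r - s)%N)) /= [X in _ + X]big1 ?addr0.
    have le : (r - s <= (r.+1 + s).+1)%N by lia.
    rewrite (big_ord_widen_cond _ xpredT
      (fun n => k`_n *: (x ^+ n * y ^+ (s - n)) * y ^+ r.+1) le) /=.
    apply: eq_bigr => n ns; rewrite -scalerAl -mulrA -exprD; do 3 f_equal.
    by move: ns rij; rewrite /s; lia.
  move=> n; rewrite -leqNgt => ns; rewrite nth_default ?scale0r //.
  exact: leq_trans sk ns.
have -> : (r.+1 + s - i = j + r.+1)%N by rewrite /s; lia.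
rewrite exprD mulrA => E; rewrite mulrBl E addrK exprZn.
by rewrite -scalerAl mulrC; congr (_ + _); rewrite -!scalerAl mulrC.
Qed.

(** P stands for membership in the sum of the two colon ideals. Each reduction keeps
    the degree i + j + k and lowers i + k, since the exponents r - (i + j) or
    more of m are the ones which disappear, and i is one of them exactly
    when r <= 2 i + j; likewise for n and k. If neither reduction applies, the
    degree is less than r. *)
Lemma monomials_in_sum_of_colons (P : A -> Prop) (l m n m' n' : A)
    (b c b' c' : F) r :
    (forall f g, P f -> P g -> P (f + g)) ->
    (forall a f, P f -> P (a *: f)) ->
    b != 0 -> c != 0 -> m' = c *: m + b *: l ->
    b' != 0 -> c' != 0 -> n' = c' *: n + b' *: l ->
    (forall f u w,
       f * l ^+ r.+1 = u * m ^+ r.+1 + w * m' ^+ r.+1 -> P f) ->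
    (forall f u w,
       f * l ^+ r.+1 = u * n ^+ r.+1 + w * n' ^+ r.+1 -> P f) ->
  forall i j k, (r <= i + j + k)%N -> P (m ^+ i * n ^+ k * l ^+ j).
Proof.
move=> PD PZ b0 c0 m'E b'0 c'0 n'E Pm Pn.
have P0 : P 0 by apply: (Pm 0 0 0); rewrite !mul0r addr0.
have Psum N (f : 'I_N -> A) : (forall i, P (f i)) -> P (\sum_i f i).
  by move=> Pf; elim/big_ind: _.
move=> i j k; have [N] := ubnP (i + k).
elim: N i j k => // N IH i j k ikN rijk.
have [rij|rij] := leqP r (2 * i + j).
  have [e [u [w E]]] := pencil_reduction b0 c0 m'E rij.
  set R := \sum_(_ < _) _ in E.
  rewrite -[m ^+ i * n ^+ k * l ^+ j](subrK (R * n ^+ k)); apply: PD.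
    apply: (Pm _ (u * n ^+ k) (w * n ^+ k)).
    by rewrite -![_ * n ^+ k * _]mulrAC -mulrDl -E; ring.
  rewrite mulr_suml; apply: Psum => q; rewrite -scalerAl mulrAC; apply: PZ.
  by apply: IH; have := ltn_ord q; lia.
have [rkj|rkj] := leqP r (2 * k + j).
  have [e [u [w E]]] := pencil_reduction b'0 c'0 n'E rkj.
  set R := \sum_(_ < _) _ in E.
  rewrite -[m ^+ i * n ^+ k * l ^+ j](subrK (R * m ^+ i)); apply: PD.
    apply: (Pn _ (u * m ^+ i) (w * m ^+ i)).
    by rewrite -![_ * m ^+ i * _]mulrAC -mulrDl -E; ring.
  rewrite mulr_suml; apply: Psum => q; rewrite -scalerAl mulrC mulrA; apply: PZ.
  by apply: IH; have := ltn_ord q; lia.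
by lia.
Qed.

End Homogenization.

(** * Homogeneous components of products *)

Section HomogeneousComponents.
Context {R : realType}.
Local Notation S := {mpoly R[3]}.

(** Taking homogeneous components makes the coefficients in a presentation of a homogeneous element of an
    ideal homogeneous. *)
Lemma pihomogMr (f g : S) d k : (k <= d)%N -> g \is k.-homog ->
  pihomog mdeg d (f * g) = pihomog mdeg (d - k) f * g.
Proof.
move=> kd hg; pose N := maxn (mmeasure mdeg f) (d - k).+1.
rewrite {1}(pihomog_partitionE (leq_maxl _ _ : (mmeasure mdeg f <= N)%N)).
have ltN : (d - k < N)%N by rewrite leq_max ltnSn orbT.
rewrite mulr_suml raddf_sum (bigD1 (Ordinal ltN)) //= big1 ?addr0 => [|i idk].
  by rewrite pihomog_dE // -{2}(subnK kd) dhomogM // pihomogP.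
apply: (@pihomog_ne0 _ _ _ (i + k)%N); last by rewrite dhomogM // pihomogP.
apply: contra idk => /eqP idk; apply/eqP/val_inj => /=.
by rewrite -idk addnK.
Qed.

End HomogeneousComponents.

(** * Linear forms and points of the plane *)

Section LinearForms.
Context {R : realType}.
Local Notation S := {mpoly R[3]}.
Implicit Types (f g l m n : S) (p q s : 'rV[R]_2).

(** Spanning the linear forms is enough to span the forms of each degree by
    monomials: induct on the degree, multiplying by one coordinate at a time. *)
Lemma homog_span (P : S -> Prop) l m n e f :
    (forall f g, P f -> P g -> P (f + g)) ->
    (forall a f, P f -> P (a *: f)) ->
    (forall i : 'I_3, exists a b c, 'X_i = a *: m + b *: n + c *: l) ->
    (forall i j k, (i + j + k)%N = e -> P (m ^+ i * n ^+ k * l ^+ j)) ->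
  f \is e.-homog -> P f.
Proof.
move=> PD PZ span Pmon hf.
suff PX mu : mdeg mu = e -> P 'X_[mu].
  rewrite [f]mpolyE big_seq; elim/big_ind: _ => //.
    have mon0 : ((e + 0) + 0 = e)%N by rewrite !addn0.
    by rewrite -(scale0r (m ^+ e * n ^+ 0 * l ^+ 0)); apply/PZ/Pmon.
  by move=> mu mu_f; apply/PZ/PX/(dhomogP _ _ _ hf).
elim: e P {hf} PD PZ Pmon mu => [|e IH] P PD PZ Pmon mu mu_e.
  have -> : mu = 0%MM by apply/eqP; rewrite -mdeg_eq0 mu_e.
  by rewrite mpolyX0; have := Pmon 0%N 0%N 0%N erefl; rewrite !expr0 !mulr1.
have [i mui] : exists i, (0 < mu i)%N.
  apply/existsP; apply: contraT; rewrite negb_exists => /forallP mu0.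
  by have := mu_e; rewrite mdegE big1 // => i _; apply/eqP; rewrite eqn0Ngt mu0.
have muE : mu = (mu - U_(i) + U_(i))%MM.
  by rewrite submK // lep1mP -lt0n.
rewrite muE mpolyXD mulrC.
have [a [b [c Xi]]] := span i.
apply: (IH (fun g => P ('X_i * g))).
- by move=> g h Pg Ph; rewrite mulrDr; apply: PD.
- by move=> d g Pg; rewrite -scalerAr; apply: PZ.
- move=> u v w uvw.
  have -> : 'X_i * (m ^+ u * n ^+ w * l ^+ v) =
      a *: (m ^+ u.+1 * n ^+ w * l ^+ v) + b *: (m ^+ u * n ^+ w.+1 * l ^+ v)
      + c *: (m ^+ u * n ^+ w * l ^+ v.+1).
    by rewrite Xi -!mul_mpolyC !exprS; ring.
  by apply: (PD); first apply: (PD); apply/PZ/Pmon; lia.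
- by move: mu_e; rewrite {1}muE mdegD mdeg1; lia.
Qed.

Definition lift_point p : 'I_3 -> R := tnth [tuple p 0 0; p 0 1; 1].

Lemma linear_formE f : f \is 1.-homog -> f = \sum_(i < 3) f@_U_(i) *: 'X_i.
Proof.
move=> hf; apply/mpolyP => mu; rewrite linear_sum /=.
under eq_bigr => i _ do rewrite mcoeffZ mcoeffX.
have [/mdeg1P[i /eqP ->]|mu1] := boolP (mdeg mu == 1%N).
  rewrite (bigD1 i) //= eqxx mulr1 big1 ?addr0 // => j ji.
  rewrite (_ : (U_(j) == U_(i))%MM = false) ?mulr0 //.
  apply/negP => /eqP/mnmP/(_ j); rewrite !mnm1E eqxx.
  by rewrite eq_sym in ji; rewrite (negPf ji).
rewrite (dhomog_nemf_coeff hf mu1) big1 // => i _.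
rewrite (_ : (U_(i) == mu)%MM = false) ?mulr0 //.
by apply: contraNF mu1 => /eqP <-; rewrite mdeg1.
Qed.

(** The expression tested is twice the signed area of the triangle p q s, also the determinant of the
    three lifted points. *)
Definition noncollinear p q s : bool :=
  (q 0 0 - p 0 0) * (s 0 1 - p 0 1) - (q 0 1 - p 0 1) * (s 0 0 - p 0 0) != 0.

Lemma noncollinearC p q s : noncollinear p q s = noncollinear p s q.
Proof. by rewrite /noncollinear -oppr_eq0; congr (_ != 0); ring. Qed.

Lemma linear_form_eq0 f p q s : f \is 1.-homog -> noncollinear p q s ->
    f.@[lift_point p] = 0 -> f.@[lift_point q] = 0 -> f.@[lift_point s] = 0 ->
  f = 0.
Proof.
move=> /linear_formE -> npqs.
set c := fun i : 'I_3 => f@_U_(i).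
have ev x : (\sum_(i < 3) f@_U_(i) *: 'X_i).@[lift_point x] =
    c ord0 * x 0 0 + c (lift ord0 ord0) * x 0 1 + c (lift ord0 (lift ord0 ord0)).
  rewrite !big_ord_recl big_ord0 addr0 !mevalD !mevalZ !mevalXU /lift_point.
  by rewrite !(tnth_nth 0) /= mulr1 addrA.
rewrite !ev !big_ord_recl big_ord0 /= -/(c _) -!/(c (lift _ _)).
move: (c _) (c _) (c _) => a2 a1 a0 hp hq hs.
have diff x : a0 * x 0 0 + a1 * x 0 1 + a2 = 0 ->
    a0 * (x 0 0 - p 0 0) + a1 * (x 0 1 - p 0 1) = 0.
  move=> hx; transitivity ((a0 * x 0 0 + a1 * x 0 1 + a2)
    - (a0 * p 0 0 + a1 * p 0 1 + a2)); first by ring.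
  by rewrite hx hp subrr.
have h0 : a0 = 0.
  apply: (mulIf npqs); rewrite mul0r.
  transitivity ((s 0 1 - p 0 1) * (a0 * (q 0 0 - p 0 0) + a1 * (q 0 1 - p 0 1))
    - (q 0 1 - p 0 1) * (a0 * (s 0 0 - p 0 0) + a1 * (s 0 1 - p 0 1))).
    by ring.
  by rewrite !diff // !mulr0 subrr.
have h1 : a1 = 0.
  apply: (mulIf npqs); rewrite mul0r.
  transitivity ((q 0 0 - p 0 0) * (a0 * (s 0 0 - p 0 0) + a1 * (s 0 1 - p 0 1))
    - (s 0 0 - p 0 0) * (a0 * (q 0 0 - p 0 0) + a1 * (q 0 1 - p 0 1))).
    by ring.
  by rewrite !diff // !mulr0 subrr.
have h2 : a2 = 0 by move: hp; rewrite h0 h1 !mul0r !add0r.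
by rewrite h0 h1 h2 !scale0r !addr0.
Qed.

(** The coefficients are read off at p and q, where two of l, m, n vanish; the
    third is fixed by the value at s. *)
Lemma linear_form_decomposition f l m n p q s :
    f \is 1.-homog -> l \is 1.-homog -> m \is 1.-homog -> n \is 1.-homog ->
    noncollinear p q s ->
    m.@[lift_point p] = 0 -> m.@[lift_point q] != 0 ->
    n.@[lift_point p] != 0 -> n.@[lift_point q] = 0 ->
    l.@[lift_point p] = 0 -> l.@[lift_point q] = 0 -> l.@[lift_point s] != 0 ->
  exists c : R, f = (f.@[lift_point q] / m.@[lift_point q]) *: m
                  + (f.@[lift_point p] / n.@[lift_point p]) *: n + c *: l.
Proof.
move=> hf hl hm hn npqs mp mq np nq lp lq ls.
pose f' := f - ((f.@[lift_point q] / m.@[lift_point q]) *: m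
              + (f.@[lift_point p] / n.@[lift_point p]) *: n).
exists (f'.@[lift_point s] / l.@[lift_point s]).
apply/eqP; rewrite -subr_eq0 opprD addrA -/f'; apply/eqP.
apply: (linear_form_eq0 _ npqs).
- by rewrite !(rpredB, rpredD, rpredZ).
- by rewrite !(mevalB, mevalD, mevalZ) mp lp !mulr0 add0r subr0 divfK // subrr.
- by rewrite !(mevalB, mevalD, mevalZ) nq lq !mulr0 addr0 subr0 divfK // subrr.
- by rewrite mevalB mevalZ divfK // subrr.
Qed.

Lemma slope_noncollinear p q s : q != p -> s != p ->
  slope p q <> slope p s -> noncollinear p q s.
Proof.
have ext (x y : 'rV[R]_2) : x 0 0 = y 0 0 -> x 0 1 = y 0 1 -> x = y.
  move=> e0 e1; apply/rowP; case=> [[|[|//]] i2].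
    by rewrite (_ : Ordinal i2 = 0) //; apply: val_inj.
  by rewrite (_ : Ordinal i2 = 1) //; apply: val_inj.
move=> qp sp sl; apply/negP => /eqP det0; apply: sl; rewrite /slope.
have [q0|q0] := eqVneq (p 0 0) (q 0 0).
  have [//|s0] := eqVneq (p 0 0) (s 0 0).
  case/eqP: qp; apply: ext => //; apply/eqP; rewrite -subr_eq0.
  rewrite q0 subrr mul0r sub0r in det0; move/eqP: det0.
  by rewrite oppr_eq0 mulf_eq0 !subr_eq0 -q0 [s 0 0 == _]eq_sym (negPf s0) orbF.
have [s0|s0] := eqVneq (p 0 0) (s 0 0).
  case/eqP: sp; apply: ext => //; apply/eqP; rewrite -subr_eq0.
  rewrite s0 subrr mulr0 subr0 in det0; move/eqP: det0.
  by rewrite mulf_eq0 !subr_eq0 -s0 [q 0 0 == _]eq_sym (negPf q0).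
congr Some; apply/eqP; rewrite eqr_div ?subr_eq0 //; last first.
- by rewrite eq_sym.
- by rewrite eq_sym.
by rewrite -subr_eq0 -oppr_eq0; apply/eqP; rewrite -[RHS]det0; ring.
Qed.

End LinearForms.

(** * Edges and triangles around an interior vertex *)

Section Faces.
Context {R : realType} {V : finType} (D : planar_complex R V).
Implicit Types (v w x z : V) (s t : {set V}).

Lemma pos_neq v w : v != w -> [set v; w]%SET \in faces D -> pos D w != pos D v.
Proof.
move=> vw /face_indep ind; apply/eqP => e.
have w' : w == v = false by rewrite eq_sym (negPf vw).
have := ind (fun u => if u == v then 1 else -1).
rewrite !big_setU1 ?inE ?vw //= !big_set1 eqxx w' subrr e -scalerDl subrr scale0r.
by move=> /(_ erefl erefl v); rewrite !inE eqxx => /(_ isT) /eqP; rewrite oner_eq0.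
Qed.

(** If the area vanished, the differences d = x - v and e = z - v would satisfy
    e_i d - d_i e = 0 for each coordinate i; affine independence of the face makes
    these relations trivial, so d = 0. *)
Lemma face_noncollinear v x z : v != x -> v != z -> x != z ->
  [set v; x; z]%SET \in faces D -> noncollinear (pos D v) (pos D x) (pos D z).
Proof.
move=> vx vz xz vxz; apply/negP => /eqP det0.
have vx_face : [set v; x]%SET \in faces D.
  apply: face_sub vxz _ _; first exact: finset.subsetUl.
  by rewrite cards2.
have := pos_neq vx vx_face; case/eqP.
have ind := face_indep vxz.
have key i : pos D x 0 i = pos D v 0 i.
  set d := pos D x - pos D v; set e := pos D z - pos D v.
  have de : d 0 0 * e 0 1 - d 0 1 * e 0 0 = 0 by rewrite -[RHS]det0 !mxE.
  have zv : z == v = false by rewrite eq_sym (negPf vz).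
  have xv : x == v = false by rewrite eq_sym (negPf vx).
  have zx : z == x = false by rewrite eq_sym (negPf xz).
  have := ind (fun u => if u == v then d 0 i - e 0 i else
                        if u == x then e 0 i else - d 0 i).
  rewrite -finset.setUA !big_setU1 ?inE ?negb_or ?vx ?vz ?xz //= !big_set1 eqxx xv eqxx zv zx.
  have -> : d 0 i - e 0 i + (e 0 i - d 0 i) = 0 by ring.
  move=> /(_ erefl).
  have -> : (d 0 i - e 0 i) *: pos D v + (e 0 i *: pos D x + - d 0 i *: pos D z)
      = e 0 i *: d - d 0 i *: e.
    by apply/rowP => j; rewrite !mxE; ring.
  have -> : e 0 i *: d - d 0 i *: e = 0.
    have I2 (k : 'I_2) : k = 0 \/ k = 1.
      by case: k => [[|[|//]] ?]; [left|right]; apply: val_inj.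
    apply/rowP => j.
    have E : e 0 1 * d 0 0 = e 0 0 * d 0 1.
      by apply/eqP; rewrite -subr_eq0; apply/eqP; rewrite -[RHS]de; ring.
    by case: (I2 i) => ->; case: (I2 j) => ->; move: E; rewrite !mxE; lra.
  move=> /(_ erefl z); rewrite !inE eqxx !orbT zv zx => /(_ isT) /eqP.
  by rewrite oppr_eq0 !mxE subr_eq0 => /eqP.
by apply/rowP.
Qed.

Lemma edge_of_face v x s : s \in faces D -> [set v; x]%SET \subset s -> v != x ->
  is_edge D [set v; x]%SET.
Proof.
move=> sD vxs vx; rewrite /is_edge cards2 vx eqxx andbT.
by apply: face_sub sD vxs _; rewrite cards2.
Qed.

(** The boundary complex contains the vertices of the boundary edges. *)
Lemma edge_not_boundary v t : interior_vertex D v -> v \in t -> ~~ boundary_edge D t.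
Proof.
rewrite /interior_vertex /interior_face !inE => /andP[vD]; rewrite vD /=.
move=> /existsPn nb vt; apply/negP => bt; move: (nb t).
by rewrite bt finset.sub1set vt.
Qed.

Lemma star_edge_interior v t : interior_vertex D v -> is_edge D t -> v \in t ->
  interior_edge D t.
Proof.
move=> iv et vt; rewrite /interior_edge et /interior_face.
have tD : t \in faces D by case/andP: et.
rewrite tD !inE tD /=; apply/existsPn => t'; apply/negP => /andP[bt' tt'].
have := edge_not_boundary iv (fintype.subsetP tt' v vt).
by rewrite bt'.
Qed.

Lemma third_vertex s t : t \subset s -> #|t| = 2%N -> #|s| = 3%N ->
  exists2 z, z \notin t & s = (z |: t)%SET.
Proof.
move=> ts t2 s3.
have /eqP/cards1P[z sz] : #|(s :\: t)%SET| = 1%N.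
  by rewrite cardsD (finset.setIidPr ts) s3 t2.
have : z \in (s :\: t)%SET by rewrite sz !inE.
rewrite inE => /andP[zt _]; exists z => //.
rewrite -sz; apply/finset.setP => u; rewrite !inE.
by have [/(fintype.subsetP ts) ->|_] := boolP (u \in t); rewrite ?orbF.
Qed.

(** The edge t lies in two triangles, and at most one of them is spanned by t
    and w. *)
Lemma triangle_avoiding v w t : pure2 D -> interior_vertex D v ->
    is_edge D t -> v \in t -> w \notin t ->
  exists s, [/\ s \in faces D, t \subset s, #|s| = 3%N & w \notin s].
Proof.
move=> Dp iv et vt wt; have /andP[tD /eqP t2] := et.
have := edge_not_boundary iv vt; rewrite /boundary_edge et /=.
set T := [set s in _ | _]%SET => T1.
have [s0 [s0D ts0 s03]] := Dp.2 t tD.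
have s0T : s0 \in T by rewrite inE s0D s03 ts0 eqxx.
have /card_gt1P[s1 [s2 [s1T s2T s12]]] : (1 < #|T|)%N.
  by rewrite ltn_neqAle eq_sym T1 /= card_gt0; apply/finset.set0Pn; exists s0.
move: s1T s2T; rewrite !inE => /and3P[s1D /eqP s13 ts1] /and3P[s2D /eqP s23 ts2].
have wE s : t \subset s -> #|s| = 3%N -> w \in s -> s = (w |: t)%SET.
  move=> ts s3 ws; have [z zt sE] := third_vertex ts t2 s3.
  by move: ws; rewrite sE !inE (negPf wt) orbF => /eqP ->.
have [w1|w1] := boolP (w \in s1); last by exists s1.
have [w2|w2] := boolP (w \in s2); last by exists s2.
by case/eqP: s12; rewrite (wE s1) // (wE s2).
Qed.

(** Take a third vertex x of a triangle on v w, then turn around the edge v x into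
    a triangle avoiding w. The edges v x and v z so obtained span
    a triangle, hence are not collinear. *)
Lemma two_more_edges v w : pure2 D -> interior_vertex D v -> v != w ->
    [set v; w]%SET \in faces D ->
  exists x z, [/\ [&& x != v, x != w, z != v, z != w & x != z],
    is_edge D [set v; x]%SET, is_edge D [set v; z]%SET
    & [set v; x; z]%SET \in faces D].
Proof.
move=> Dp iv vw vwD.
have [s [sD vws s3]] := Dp.2 _ vwD.
have vw2 : #|[set v; w]%SET| = 2%N by rewrite cards2 vw.
have [x xvw sE] := third_vertex vws vw2 s3.
move: xvw; rewrite !inE negb_or => /andP[xv xw].
have vx : v != x by rewrite eq_sym.
have evx : is_edge D [set v; x]%SET.
  apply: edge_of_face sD _ vx; rewrite sE; apply/fintype.subsetP => u.
  by rewrite !inE => /orP[] ->; rewrite ?orbT.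
have wvx : w \notin [set v; x]%SET by rewrite !inE negb_or eq_sym vw eq_sym xw.
have vvx : v \in [set v; x]%SET by rewrite !inE eqxx.
have [s' [s'D vxs' s'3 ws']] := triangle_avoiding Dp iv evx vvx wvx.
have vx2 : #|[set v; x]%SET| = 2%N by rewrite cards2 vx.
have [z zvx s'E] := third_vertex vxs' vx2 s'3.
move: zvx; rewrite !inE negb_or => /andP[zv zx].
exists x, z; split=> //.
- rewrite xv xw zv [x == z]eq_sym zx /= andbT; apply: contraNneq ws' => <-.
  by rewrite s'E !inE eqxx.
- apply: edge_of_face s'D _ _; last by rewrite eq_sym.
  by rewrite s'E; apply/fintype.subsetP => u; rewrite !inE => /orP[] ->; rewrite ?orbT.
- by rewrite finset.setUC -s'E.
Qed.

Lemma star_edge_partially_interior v t0 t : interior_vertex D v ->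
    [set t | totally_interior D t]%SET = [set t0]%SET ->
    is_edge D t -> v \in t -> t != t0 -> partially_interior D t.
Proof.
move=> iv one et vt tt0.
have : ~~ totally_interior D t.
  apply: contra tt0 => it.
  by move/finset.setP/(_ t): one; rewrite !inE it => <-.
rewrite /totally_interior /partially_interior et /=.
have t2 : #|t| = 2%N by case/andP: et => _ /eqP.
set I := [set u in _ | _]%SET.
have : (0 < #|I|)%N by rewrite card_gt0; apply/finset.set0Pn; exists v; rewrite inE vt.
have : (#|I| <= 2)%N.
  by rewrite -t2; apply/subset_leq_card/fintype.subsetP => u; rewrite inE => /andP[].
by case: #|I| => [|[|[|?]]].
Qed.

End Faces.

(** * Forms of the edges at an interior vertex *)

Section LocalPencil.
Context {R : realType} {V : finType} (D : planar_complex R V).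
Context (l : {set V} -> {mpoly R[3]}) (l_forms : edge_forms D l).

Lemma edge_form_vertex t v : is_edge D t -> v \in t ->
  (l t).@[lift_point (pos D v)] = 0.
Proof.
move=> et vt; have [_ _ h] := l_forms et; apply: h.
exists (pos D v); last by exists 1; rewrite ?ler01 // !mul1r.
exists (fun u => (u == v)%:R); split.
- by move=> u; rewrite ler0n.
- rewrite (bigD1 v) //= eqxx big1 ?addr0 // => u /andP[_ uv].
  by rewrite (negPf uv).
- rewrite (bigD1 v) //= eqxx scale1r big1 ?addr0 // => u /andP[_ uv].
  by rewrite (negPf uv) scale0r.
Qed.

Lemma edge_form_neq0 v x p : is_edge D [set v; x]%SET ->
  noncollinear (pos D v) (pos D x) p -> (l [set v; x]%SET).@[lift_point p] != 0.
Proof.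
move=> e nc; have [hl l0 _] := l_forms e; apply: contra_neq l0 => lp.
by apply: linear_form_eq0 nc _ _ lp => //; apply: edge_form_vertex => //;
  rewrite !inE eqxx ?orbT.
Qed.

(** The linear forms vanishing at v form a pencil; evaluating at w and x gives the
    coordinates c and b of the form of t' in the basis made of the forms of t and
    of v w. They are nonzero because t' is parallel to neither of these edges: for
    v w this is the slope condition, for t it is that t and t' span a face. *)
Lemma edges_at_interior_vertex v w : pure2 D -> slope_condition D ->
    [set t | totally_interior D t]%SET = [set [set v; w]]%SET ->
    interior_vertex D v -> v != w -> is_edge D [set v; w]%SET ->
  exists t t' x, [/\ [/\ is_edge D t, v \in t & t != [set v; w]%SET],
    [/\ is_edge D t', v \in t' & t' != [set v; w]%SET],
    noncollinear (pos D v) (pos D w) (pos D x),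
    (l t).@[lift_point (pos D w)] != 0
    & exists b c, [/\ b != 0, c != 0 & l t' = c *: l t + b *: l [set v; w]%SET]].
Proof.
move=> Dp Ds one iv vw evw.
have vwD : [set v; w]%SET \in faces D by case/andP: evw.
have [x [z [/and5P[xv xw zv zw xz] ex ez vxz]]] := two_more_edges Dp iv vw vwD.
have neq u : u != v -> u != w -> [set v; u]%SET != [set v; w]%SET.
  move=> uv uw; apply/eqP => /setP/(_ u); rewrite !inE eqxx orbT.
  by rewrite (negPf uv) (negPf uw).
have nc u : u != v -> u != w -> is_edge D [set v; u]%SET ->
    noncollinear (pos D v) (pos D u) (pos D w).
  move=> uv uw eu; apply: slope_noncollinear.
  - by apply: pos_neq; [rewrite eq_sym|case/andP: eu].
  - exact: pos_neq.
  - apply: Ds => //.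
    apply: (star_edge_partially_interior iv one eu _ (neq u uv uw)).
    by rewrite !inE eqxx.
  - by have := finset.set11 [set v; w]%SET; rewrite -one inE.
have nvwx := nc x xv xw ex; rewrite noncollinearC in nvwx.
have nvxz : noncollinear (pos D v) (pos D x) (pos D z).
  by apply: face_noncollinear; rewrite // eq_sym.
have vin y : v \in [set v; y]%SET by rewrite !inE eqxx.
have yin y : y \in [set v; y]%SET by rewrite !inE eqxx orbT.
have mw := edge_form_neq0 ex (nc x xv xw ex).
have m'w := edge_form_neq0 ez (nc z zv zw ez).
have m'x : (l [set v; z]%SET).@[lift_point (pos D x)] != 0.
  by apply: edge_form_neq0 ez _; rewrite noncollinearC.
have lx := edge_form_neq0 evw nvwx.
exists [set v; x]%SET, [set v; z]%SET, x; split=> //.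
- by split=> //; apply: neq.
- by split=> //; apply: neq.
set m := l [set v; x]%SET; set m' := l [set v; z]%SET; set l0 := l [set v; w]%SET.
exists (m'.@[lift_point (pos D x)] / l0.@[lift_point (pos D x)]).
exists (m'.@[lift_point (pos D w)] / m.@[lift_point (pos D w)]).
split; [by rewrite mulf_neq0 ?invr_neq0 //..|].
apply/eqP; rewrite -subr_eq0; apply/eqP.
have [[hm _ _] [hm' _ _] [hl0 _ _]] :=
  And3 (l_forms ex) (l_forms ez) (l_forms evw).
have [mv m'v l0v] : [/\ m.@[lift_point (pos D v)] = 0,
    m'.@[lift_point (pos D v)] = 0 & l0.@[lift_point (pos D v)] = 0].
  by split; apply: edge_form_vertex.
have mx : m.@[lift_point (pos D x)] = 0 by apply: edge_form_vertex.
have l0w : l0.@[lift_point (pos D w)] = 0 by apply: edge_form_vertex.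
apply: (linear_form_eq0 _ nvwx).
- by rewrite !(rpredB, rpredD, rpredZ).
- by rewrite !(mevalB, mevalD, mevalZ) mv m'v l0v !mulr0 addr0 subr0.
- by rewrite !(mevalB, mevalD, mevalZ) l0w mulr0 addr0 divfK // subrr.
- by rewrite !(mevalB, mevalD, mevalZ) mx mulr0 add0r divfK // subrr.
Qed.

End LocalPencil.

(** * Boundaries of chains supported on one edge *)

Section Boundaries.
Context {R : realType} {V : finType} (D : planar_complex R V).
Context (r : nat) (l : {set V} -> {mpoly R[3]}).
Local Notation S := {mpoly R[3]}.
Local Notation bds := (boundaries D r l).
Implicit Types (v w u : V) (t : {set V}) (P Q : S).

Definition chain_at v P : {ffun V -> S} := [ffun u => if u == v then P else 0].

Lemma chain_atD v P Q : chain_at v (P + Q) = chain_at v P + chain_at v Q.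
Proof. by apply/ffunP => u; rewrite !ffunE; case: eqP; rewrite ?addr0. Qed.

Lemma boundariesD F F' : bds F -> bds F' -> bds (F + F').
Proof.
move=> [G cG <-] [G' cG' <-]; exists (G + G').
  move=> t; move: (cG t) (cG' t); rewrite ffunE.
  case: ifP => _; last by move=> -> ->; rewrite addr0.
  by move=> [g ->] [g' ->]; exists (g + g'); rewrite mulrDl.
apply/ffunP => v; rewrite !ffunE; case: ifP => _; last by rewrite addr0.
by rewrite -big_split; apply: eq_bigr => t _; rewrite /= ffunE mulrDr.
Qed.

Lemma boundariesM Q F : bds F -> bds [ffun v => Q * F v].
Proof.
move=> [G cG <-]; exists [ffun t => Q * G t].
  move=> t; move: (cG t); rewrite ffunE; case: ifP => _ => [[g ->]|->].
    by exists (Q * g); rewrite mulrA.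
  by rewrite mulr0.
apply/ffunP => v; rewrite !ffunE; case: ifP => _; last by rewrite mulr0.
by rewrite mulr_sumr; apply: eq_bigr => t _; rewrite ffunE mulrCA.
Qed.

Lemma boundaries0 : bds 0.
Proof.
exists 0; first by move=> t; rewrite ffunE; case: ifP => // _; exists 0; rewrite mul0r.
apply/ffunP => v; rewrite !ffunE; case: ifP => // _.
by rewrite big1 // => t _; rewrite ffunE mulr0.
Qed.

Lemma chain_atM v P Q : bds (chain_at v P) -> bds (chain_at v (Q * P)).
Proof.
move/(boundariesM Q); congr (bds _); apply/ffunP => u; rewrite !ffunE.
by case: ifP => _ //; rewrite mulr0.
Qed.

Lemma boundariesN F : bds F -> bds (- F).
Proof.
by move/(boundariesM (- 1)); congr (bds _); apply/ffunP => u; rewrite !ffunE mulN1r.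
Qed.

(** Being a sign, the coefficient is its own inverse, so a chain on t can be rescaled
    to have any prescribed element of the ideal of t as its boundary component at u. *)
Lemma bd_coef_sqr t u : is_edge D t -> u \in t ->
  @bd_coef R V t [set u]%SET * @bd_coef R V t [set u]%SET = 1.
Proof.
move=> /andP[_ /eqP t2] ut.
have /eqP/cards1P[y ty] : #|(t :\ u)%SET| = 1%N by have := cardsD1 u t; rewrite ut t2; lia.
have tE : t = [set u; y]%SET by rewrite -ty finset.setD1K.
have uy : u != y by move/finset.setP/(_ u): ty; rewrite !inE eqxx => /esym/negbT.
rewrite /bd_coef (big_pred1 y); first by rewrite -expr2 sqrr_sign.
move=> x; rewrite /= tE !inE; apply/andP/eqP => [[/orP[/eqP ->|/eqP //]]|->].
  by move/eqP/finset.setP/(_ u); rewrite !inE !eqxx.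
rewrite eqxx orbT; split=> //; apply/eqP/finset.setP => z; rewrite !inE.
by have [->|] := eqVneq z y; rewrite ?orbF //= eq_sym (negPf uy).
Qed.

Lemma bd_coef_notin t u : u \notin t -> @bd_coef R V t [set u]%SET = 0.
Proof.
move=> ut; rewrite /bd_coef big1 // => x /andP[_ /eqP/finset.setP/(_ u)].
by rewrite !inE eqxx (negPf ut) andbF.
Qed.

Lemma boundary_of_edge t P : interior_edge D t -> J1 r l t P ->
  bds [ffun u => if interior_vertex D u then bd_coef t [set u]%SET * P else 0].
Proof.
move=> it Pt; exists [ffun s => if s == t then P else 0].
  move=> s; rewrite ffunE; have [->|_] := eqVneq s t; first by rewrite it.
  by case: ifP => // _; exists 0; rewrite mul0r.
apply/ffunP => u; rewrite !ffunE; case: ifP => // _.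
rewrite (bigD1 t) //= ffunE eqxx big1 ?addr0 // => s /andP[_ st].
by rewrite ffunE (negPf st) mulr0.
Qed.

(** Since t0 is the only totally interior edge, v is the only interior vertex
    of t, so the relative boundary of t has one component. *)
Lemma chain_at_partial t0 v t P :
    [set t | totally_interior D t]%SET = [set t0]%SET ->
    interior_vertex D v -> is_edge D t -> v \in t -> t != t0 ->
  J1 r l t P -> bds (chain_at v P).
Proof.
move=> one iv et vt tt0 Pt.
have only u : interior_vertex D u -> u \in t -> u = v.
  have /andP[_ /cards1P[y /finset.setP I]] := star_edge_partially_interior iv one et vt tt0.
  move=> iu ut; have := I u; have := I v; rewrite !inE iu iv ut vt.
  by move=> /esym/eqP -> /esym/eqP.
have [g PE] := Pt.
have ct : J1 r l t (bd_coef t [set v]%SET * P).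
  by exists (bd_coef t [set v]%SET * g); rewrite PE mulrA.
have := boundary_of_edge (star_edge_interior iv et vt) ct.
congr (bds _); apply/ffunP => u; rewrite !ffunE.
have [->|uv] := eqVneq u v; first by rewrite iv mulrA bd_coef_sqr // mul1r.
case: ifP => // iu; rewrite bd_coef_notin ?mul0r //.
by apply: contra uv => ut; rewrite (only u).
Qed.

(** Up to signs, the boundary of the edge v w carrying P has P at both ends. *)
Lemma chain_at_transport v w P : v != w -> is_edge D [set v; w]%SET ->
    interior_vertex D v -> interior_vertex D w ->
    J1 r l [set v; w]%SET P ->
  bds (chain_at v P) -> bds (chain_at w P).
Proof.
move=> vw e iv iw [g PE] Bv; set t := [set v; w]%SET in e PE.
have vt : v \in t by rewrite !inE eqxx.
have wt : w \in t by rewrite !inE eqxx orbT.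
pose cw : S := bd_coef t [set w]%SET; pose cv : S := bd_coef t [set v]%SET.
have ct : J1 r l t (cw * P) by exists (cw * g); rewrite PE mulrA.
have B1 := boundary_of_edge (star_edge_interior iv e vt) ct.
have := boundariesD B1 (boundariesN (chain_atM (cv * cw) Bv)).
congr (bds _); apply/ffunP => u; rewrite !ffunE.
have [->|uw] := eqVneq u w.
  by rewrite iw eq_sym (negPf vw) mulrA bd_coef_sqr // mul1r subr0.
have [->|uv] := eqVneq u v; first by rewrite iv mulrA subrr.
rewrite subr0; case: ifP => // _; rewrite bd_coef_notin ?mul0r //.
by rewrite !inE negb_or uv.
Qed.

End Boundaries.

(** * Vanishing in high degree *)

Section Vanishing.
Context {R : realType} {V : finType} {r : nat} (D : planar_complex R V).
Context (l : {set V} -> {mpoly R[3]}) (l_forms : edge_forms D l).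
Local Notation bds := (boundaries D r l).

(** The property of f that f * l0 ^+ r.+1 at v is a boundary holds on the colon
    ideal at v by [chain_at_partial], and on the colon ideal at w after
    transport along v w; the reduction of monomials concludes. *)
Lemma chain_at_total v w e g : pure2 D -> slope_condition D ->
    [set t | totally_interior D t]%SET = [set [set v; w]]%SET ->
    v != w -> is_edge D [set v; w]%SET ->
    interior_vertex D v -> interior_vertex D w ->
    (r <= e)%N -> g \is e.-homog ->
  bds (chain_at v (g * l [set v; w]%SET ^+ r.+1)).
Proof.
move=> Dp Ds one vw evw iv iw re hg.
have wv : w != v by rewrite eq_sym.
have wvE : [set w; v]%SET = [set v; w]%SET by rewrite finset.setUC.
have onew : [set t | totally_interior D t]%SET = [set [set w; v]]%SET.
  by rewrite wvE.
have eww : is_edge D [set w; v]%SET by rewrite wvE.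
have [t [t' [x [[et vt tn] [et' vt' tn'] nc mw [b [c [b0 c0 mE]]]]]]] :=
  edges_at_interior_vertex l_forms Dp Ds one iv vw evw.
have [s [s' [_ [[es ws sn] [es' ws' sn'] _ nv [b' [c' [b'0 c'0 nE]]]]]]] :=
  edges_at_interior_vertex l_forms Dp Ds onew iw wv eww.
rewrite wvE in sn sn' nE.
set l0 := l [set v; w]%SET in mE nE *.
pose P f := bds (chain_at v (f * l0 ^+ r.+1)).
have PD f f' : P f -> P f' -> P (f + f').
  by rewrite /P mulrDl chain_atD; apply: boundariesD.
have PZ a f : P f -> P (a *: f).
  by rewrite /P -mul_mpolyC -mulrA; apply: chain_atM.
rewrite -/(P g).
apply: (homog_span PD PZ _ _ hg); last first.
  move=> i j k ijk; rewrite -ijk in re.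
  apply: (monomials_in_sum_of_colons PD PZ b0 c0 mE b'0 c'0 nE (r := r)) => //.
    move=> f u u' fE; rewrite /P fE chain_atD; apply: boundariesD.
      by apply: (chain_at_partial one iv et vt tn); exists u.
    by apply: (chain_at_partial one iv et' vt' tn'); exists u'.
  move=> f u u' fE; apply: (@chain_at_transport _ _ D r l w v) => //.
    by rewrite wvE; exists f.
  rewrite fE chain_atD; apply: boundariesD.
    by apply: (chain_at_partial one iw es ws sn); exists u.
  by apply: (chain_at_partial one iw es' ws' sn'); exists u'.
move=> i.
have hX : 'X_i \is [in R[3], 1.-homog] by rewrite dhomogX; apply/eqP; exact: mdeg1.
have [hl0 _ _] := l_forms evw.
have [hm _ _] := l_forms et.
have [hn _ _] := l_forms es.
have v0 : v \in [set v; w]%SET by rewrite !inE eqxx.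
have w0 : w \in [set v; w]%SET by rewrite !inE eqxx orbT.
have lv := edge_form_vertex l_forms evw v0.
have lw := edge_form_vertex l_forms evw w0.
have mv := edge_form_vertex l_forms et vt.
have nw := edge_form_vertex l_forms es ws.
have lx := edge_form_neq0 l_forms evw nc.
have [a aE] := linear_form_decomposition hX hl0 hm hn nc mv mw nv nw lv lw lx.
by eexists; eexists; exists a; exact: aE.
Qed.

(** Decompose F into the contributions of the edges at each interior vertex, made
    homogeneous of degree d. Only those of the totally interior edge
    are not boundaries for trivial reasons, and their coefficients have
    degree d - r - 1 >= r. *)
Lemma high_degree_boundary d F : pure2 D -> slope_condition D ->
    #|[set t | totally_interior D t]%SET| = 1%N -> (2 * r < d)%N ->
    chains0 D r l F -> (forall v, F v \is d.-homog) ->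
  bds F.
Proof.
move=> Dp Ds /eqP/cards1P[t0 one] rd cF hF.
have /andP[et0 /eqP I2] : totally_interior D t0.
  by move/finset.setP/(_ t0): one; rewrite !inE eqxx.
have t02 : #|t0| = 2%N by case/andP: et0 => _ /eqP.
have it0 v : v \in t0 -> interior_vertex D v.
  have /eqP <- : [set v in t0 | interior_vertex D v]%SET == t0.
    rewrite eqEcard I2 t02 leqnn andbT.
    by apply/fintype.subsetP => u; rewrite inE => /andP[].
  by rewrite inE => /andP[].
have FE : F = \sum_v chain_at v (F v).
  apply/ffunP => u; rewrite sum_ffunE (bigD1 u) //= ffunE eqxx big1 ?addr0 // => v vu.
  by rewrite ffunE eq_sym (negPf vu).
rewrite FE; elim/big_ind: _ => [|F1 F2|v _]; first exact: boundaries0.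
  exact: boundariesD.
have := cF v; case: ifP => [iv [h hJ FvE]|_ ->]; last first.
  rewrite (_ : chain_at v 0 = 0); first exact: boundaries0.
  by apply/ffunP => u; rewrite !ffunE if_same.
rewrite -(pihomog_dE (hF v)) FvE raddf_sum /=.
elim/big_ind: _ => [|P Q|t /andP[et vt]].
- rewrite (_ : chain_at v 0 = 0); first exact: boundaries0.
  by apply/ffunP => u; rewrite !ffunE if_same.
- by rewrite chain_atD; apply: boundariesD.
have [g ->] := hJ t et vt.
have hl : l t ^+ r.+1 \is r.+1.-homog.
  by have [hl _ _] := l_forms et; have := dhomogMn r.+1 hl; rewrite mul1n.
rewrite (pihomogMr _ _ hl); last by lia.
set g' := pihomog _ _ _.
have hg' : g' \is (d - r.+1).-homog by apply: pihomogP.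
have [tt0|tt0] := eqVneq t t0; last first.
  by apply: (chain_at_partial one iv et vt tt0); exists g'.
have /eqP/cards1P[w tw] : #|(t :\ v)%SET| = 1%N.
  by have := cardsD1 v t; rewrite vt tt0 t02; lia.
have tE : t = [set v; w]%SET by rewrite -tw finset.setD1K.
have vw : v != w by move/finset.setP/(_ v): tw; rewrite !inE eqxx => /esym/negbT.
rewrite tE; apply: (chain_at_total (e := (d - r.+1)%N)) => //.
- by rewrite -tE tt0.
- by rewrite -tE.
- by apply: it0; rewrite -tt0 tE !inE eqxx orbT.
- by lia.
Qed.

End Vanishing.

Theorem theorem2 (R : realType) (V : finType) (r : nat)
    (D : planar_complex R V) (l : {set V} -> {mpoly R[3]})
    (D_connected : connected (realization D))
    (D_pure : pure2 D)
    (D_genus0 : genus0 D)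
    (D_slopes : slope_condition D)
    (D_one : #|[set t | totally_interior D t]%SET| = 1%N)
    (l_forms : edge_forms D l) :
  (reg_H0 D r l <= ((2 * r)%:R)%:E)%E.
Proof.
apply: ge_ereal_sup => _ [d [c [F [cF hF] <-] ne] <-].
rewrite lee_fin ler_nat leqNgt; apply/negP => rd; apply: ne.
have BF := high_degree_boundary l_forms D_pure D_slopes D_one rd cF hF.
apply/seteqP; split => F' /= BF'; rewrite /coset0 /= in BF' *.
  by rewrite subr0 -(subrK F F'); apply: boundariesD.
by rewrite subr0 in BF'; apply: boundariesD => //; apply: boundariesN.
Qed.
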